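(* Let $X,Y\in M_n(\mathbb{C})_{++}$. If $n\le3$ and $\operatorname{OLC}(XY)=\operatorname{OLC}(X)+\operatorname{OLC}(Y)$, then $XY=YX$. Moreover, $n=4$ is the smallest dimension in which noncommuting equality cases can occur: there exist $X,Y\in M_4(\mathbb{C})_{++}$ with $\operatorname{OLC}(XY)=\operatorname{OLC}(X)+\operatorname{OLC}(Y)$ and $XY\neq YX$.
   Context: $M_n(\mathbb{C})_{++}$ denotes the positive definite (Hermitian, invertible) $n\times n$ complex matrices. For an invertible matrix $A$, with $\|\cdot\|$ the operator (spectral) norm, $\kappa(A):=\|A\|\,\|A^{-1}\|$ and $\operatorname{OLC}(A):=\tfrac12\ln\kappa(A)$. *)

(* Defs.v *)
From HB Require Import structures.
From mathcomp Require Import all_boot all_order all_algebra.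
From mathcomp Require Import complex.
From mathcomp Require Import classical_sets reals exp.

Set Implicit Arguments.
Unset Strict Implicit.
Unset Printing Implicit Defensive.

Import Order.TTheory GRing.Theory Num.Theory.
Local Open Scope classical_set_scope.
Local Open Scope ring_scope.
Local Open Scope sesquilinear_scope.

(* On R[i], [0 < z] means that z is real and positive. *)
Definition posdefmx (R : realType) (n : nat) (A : 'M[R[i]]_n) : Prop :=
  A \is hermsymmx /\
  forall x : 'cV[R[i]]_n, x != 0 -> 0 < (x ^t* *m A *m x) 0 0.

Definition l2norm (R : realType) (n : nat) (x : 'cV[R[i]]_n) : R :=
  Num.sqrt (\sum_(i < n) Normc.normc (x i 0) ^+ 2).

(* The closed unit ball, rather than the unit sphere, keeps the set nonempty
   when n = 0. *)
Definition opnorm (R : realType) (n : nat) (A : 'M[R[i]]_n) : R :=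
  sup [set l2norm (A *m x) | x in [set x : 'cV[R[i]]_n | l2norm x <= 1]].

(* Meaningful only for invertible A: [invmx A] is A otherwise. *)
Definition kappa (R : realType) (n : nat) (A : 'M[R[i]]_n) : R :=
  opnorm A * opnorm (invmx A).

Definition OLC (R : realType) (n : nat) (A : 'M[R[i]]_n) : R :=
  2^-1 * ln (kappa A).

(* Main.v *)
(* Equality of the OLCs forces |XY| = |X||Y| and |Y^-1 X^-1| = |Y^-1||X^-1|, since
   both are upper bounds. A vector v at which XY attains its norm is then a
   common eigenvector of X and Y for the eigenvalues |X| and |Y|; likewise some w
   is one for 1/|X^-1| and 1/|Y^-1|. If the two eigenvalues of X agree, X is
   scalar. Otherwise C = XY - YX kills the independent vectors v and w, so it has
   rank at most n - 2 <= 1; being skew-Hermitian of trace 0, it vanishes.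
   In dimension 4 this leaves a free 2x2 block: for X = 4 (+) B (+) 1 and
   Y = 4 (+) B' (+) 1 with 1 <= B, B' <= 4, equality holds whatever B and B' are. *)
Require Import Defs.
From HB Require Import structures.
From mathcomp Require Import all_boot all_order all_algebra.
From mathcomp Require Import complex.
From mathcomp Require Import classical_sets reals exp.
From mathcomp Require Import ring lra.

Set Implicit Arguments.
Unset Strict Implicit.
Unset Printing Implicit Defensive.

Import Order.TTheory GRing.Theory Num.Theory.
Local Open Scope ring_scope.
Local Open Scope sesquilinear_scope.
Local Open Scope complex_scope.

(** * Adjoints *)

Lemma trmxC_mul (C : numClosedFieldType) (m n p : nat)
    (A : 'M[C]_(m, n)) (B : 'M[C]_(n, p)) :
  (A *m B)^t* = B^t* *m A^t*.
Proof. by rewrite trmx_mul map_mxM. Qed.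

Lemma hermsymmxP (C : numClosedFieldType) (n : nat) (A : 'M[C]_n) :
  reflect (A^t* = A) (A \is hermsymmx).
Proof.
apply: (iffP (is_hermitianmxP _ _ _)); rewrite expr0 scale1r => h; exact: esym.
Qed.

Lemma mulmx_cV_inj (K : pzRingType) (m n : nat) (A B : 'M[K]_(m, n)) :
  (forall x : 'cV_n, A *m x = B *m x) -> A = B.
Proof.
move=> AB; apply/matrixP => i j.
by have /colP/(_ i) := AB (delta_mx j 0); rewrite -!colE !mxE.
Qed.

Section OperatorNorm.
Variable R : realType.

(** * The Euclidean norm *)

Lemma conjC_real (c : R) : Num.conj c%:C = c%:C.
Proof. exact: conjc_real. Qed.

Lemma l2norm_ge0 n (x : 'cV[R[i]]_n) : 0 <= l2norm x.
Proof. exact: sqrtr_ge0. Qed.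

Lemma sqr_l2norm n (x : 'cV[R[i]]_n) :
  l2norm x ^+ 2 = \sum_(i < n) Normc.normc (x i 0) ^+ 2.
Proof. by rewrite sqr_sqrtr // sumr_ge0 // => i _; exact: sqr_ge0. Qed.

Lemma sqr_l2normC n (x : 'cV[R[i]]_n) :
  (l2norm x ^+ 2)%:C = (x^t* *m x) 0 0.
Proof.
rewrite sqr_l2norm rmorph_sum mxE /=; apply: eq_bigr => i _.
by rewrite !mxE rmorphXn /= [RHS]mulrC -normCK.
Qed.

(** The two cross terms are conjugate but need not be real, so the expansion lives in [R[i]]. *)
Lemma sqr_l2normBZ n (x y : 'cV[R[i]]_n) (c : R) :
  (l2norm (x - c%:C *: y) ^+ 2)%:C =
  (l2norm x ^+ 2)%:C - c%:C * (x^t* *m y) 0 0 - c%:C * (y^t* *m x) 0 0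
  + (c ^+ 2 * l2norm y ^+ 2)%:C.
Proof.
rewrite [(c ^+ 2 * _)%:C]rmorphM /= !sqr_l2normC [(x - _)^T]linearB /= [(_ *: y)^T]linearZ /=.
rewrite map_mxB map_mxZ /= conjC_real.
rewrite mulmxBl !mulmxBr -!scalemxAl -!scalemxAr !mxE rmorphXn /=; ring.
Qed.

Lemma l2norm_eq0 n (x : 'cV[R[i]]_n) : (l2norm x == 0) = (x == 0).
Proof.
apply/idP/eqP => [|->]; last first.
  by rewrite -sqrf_eq0 sqr_l2norm big1// => i _; rewrite mxE Normc.normc0 expr0n.
rewrite -sqrf_eq0 sqr_l2norm psumr_eq0 => [/allP h|i _]; last exact: sqr_ge0.
apply/colP => i; rewrite mxE; apply: Normc.eq0_normc.
by apply/eqP; rewrite -sqrf_eq0; apply: h; rewrite mem_index_enum.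
Qed.

Lemma l2normZ n (a : R) (x : 'cV[R[i]]_n) :
  0 <= a -> l2norm (a%:C *: x) = a * l2norm x.
Proof.
move=> a0; apply/(pexpIrn (n := 2)) => //.
- exact: l2norm_ge0.
- by rewrite nnegrE mulr_ge0// l2norm_ge0.
rewrite exprMn !sqr_l2norm mulr_sumr; apply: eq_bigr => i _.
by rewrite mxE Normc.normcM exprMn /= expr0n addr0 sqr_sqrtr ?sqr_ge0.
Qed.

Lemma l2norm_unitary n (P : 'M[R[i]]_n) (x : 'cV[R[i]]_n) :
  P \is unitarymx -> l2norm (P *m x) = l2norm x.
Proof.
move=> Pu; apply/(pexpIrn (n := 2)); rewrite ?nnegrE ?l2norm_ge0//.
apply: complexI; rewrite !sqr_l2normC trmxC_mul -mulmxA (mulmxA _ P).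
by rewrite -[P^t* ]mul1mx mulmxKtV // mul1mx.
Qed.

(** * The operator norm as an attained maximum *)

(* The maximum is attained at an eigenvector of the largest eigenvalue of A^* A. *)
Lemma ex_max_l2norm n (A : 'M[R[i]]_n.+1) :
  exists2 v, l2norm v = 1 & forall x, l2norm (A *m x) <= l2norm (A *m v) * l2norm x.
Proof.
pose K := A^t* *m A.
have Kh : K \is hermsymmx by apply/hermsymmxP; rewrite trmxC_mul trmxCK.
pose P : 'M[R[i]]_n.+1 := spectralmx K; pose d : 'rV[R[i]]_n.+1 := spectral_diag K.
have Pu : P \is unitarymx := spectral_unitarymx K.
(* The eigenvalues of the Hermitian [K] are real; their real parts can be compared in [R]. *)
pose r j := complex.Re (d 0 j).
have dr j : (r j)%:C = d 0 j.
  by apply: RRe_real; move: (hermitian_spectral_diag_real Kh) => /mxOverP; exact.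
have normA x : l2norm (A *m x) ^+ 2 =
    \sum_j r j * Normc.normc ((P *m x) j 0) ^+ 2.
  apply: complexI; rewrite sqr_l2normC trmxC_mul -mulmxA (mulmxA (A^t*)) -/K.
  rewrite (orthomx_spectralP (hermitian_normalmx Kh)) -/P -/d.
  rewrite invmx_unitary // -!mulmxA mulmxA -trmxC_mul mxE rmorph_sum /=.
  apply: eq_bigr => j _; rewrite mul_diag_mx !mxE rmorphM rmorphXn /= dr.
  rewrite mulrCA; congr (_ * _).
  by rewrite mulrC -normCK.
pose j0 := [arg max_(j > ord0 | true) r j]%O.
have j0max j : r j <= r j0.
  by rewrite /j0; case: arg_maxP => // k _; apply.
pose v : 'cV[R[i]]_n.+1 := P^t* *m delta_mx j0 0.
have Pv : P *m v = delta_mx j0 0 by rewrite mulmxA (unitarymxP Pu) mul1mx.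
have sum_delta (f : 'I_n.+1 -> R) :
    \sum_j f j * Normc.normc ((delta_mx j0 0 : 'cV[R[i]]_n.+1) j 0) ^+ 2 = f j0.
  rewrite (bigD1 j0)//= mxE !eqxx Normc.normc1 expr1n mulr1 big1 ?addr0// => j.
  by move=> /negbTE jj0; rewrite mxE jj0 Normc.normc0 expr0n mulr0.
have unitv : l2norm v = 1.
  apply/(pexpIrn (n := 2)); rewrite ?nnegrE ?l2norm_ge0// expr1n.
  rewrite -(l2norm_unitary _ Pu) Pv sqr_l2norm -[RHS](sum_delta (fun=> 1)).
  by under [RHS]eq_bigr do rewrite mul1r.
exists v => // x.
rewrite -(@ler_pXn2r _ 2) ?nnegrE ?mulr_ge0 ?l2norm_ge0//.
rewrite exprMn -(l2norm_unitary x Pu) !normA Pv sum_delta sqr_l2norm mulr_sumr.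
by apply: ler_sum => j _; rewrite ler_wpM2r ?sqr_ge0.
Qed.

(** The maximizing unit vector lies in the closed ball and its value bounds the whole set, so the
    supremum is that value. *)
Lemma opnormP n (A : 'M[R[i]]_n.+1) :
  exists v, [/\ l2norm v = 1, l2norm (A *m v) = opnorm A &
    forall x, l2norm (A *m x) <= opnorm A * l2norm x].
Proof.
have [v v1 vmax] := ex_max_l2norm A.
suff -> : opnorm A = l2norm (A *m v) by exists v.
set E := [set l2norm (A *m x) | x in [set x : 'cV[R[i]]_n.+1 | l2norm x <= 1]]%classic.
have Eub : ubound E (l2norm (A *m v)).
  move=> _ [x /= x1 <-]; apply: le_trans (vmax x) _.
  by rewrite ler_piMr ?l2norm_ge0.
have vE : E (l2norm (A *m v)) by exists v => //=; rewrite v1.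
apply/eqP; rewrite eq_le; apply/andP; split.
  by apply: sup_le_ub => //; exists (l2norm (A *m v)).
by apply: ub_le_sup => //; exists (l2norm (A *m v)).
Qed.

Lemma l2norm_mul_le n (A : 'M[R[i]]_n.+1) x : l2norm (A *m x) <= opnorm A * l2norm x.
Proof. by have [v [_ _]] := opnormP A. Qed.

Lemma opnorm_ge0 n (A : 'M[R[i]]_n.+1) : 0 <= opnorm A.
Proof. by have [v [_ <- _]] := opnormP A; exact: l2norm_ge0. Qed.

Lemma opnorm_gt0 n (A : 'M[R[i]]_n.+1) : A \in unitmx -> 0 < opnorm A.
Proof.
move=> Au; have [v [v1 <- _]] := opnormP A.
rewrite lt_def l2norm_ge0 andbT l2norm_eq0; apply/eqP => Av0.
have v0 : v = 0 by rewrite -(mulKmx Au v) Av0 mulmx0.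
by have /eqP := v1; rewrite v0 (eqP (_ : l2norm 0 == 0)) ?l2norm_eq0// eq_sym oner_eq0.
Qed.

Lemma opnormM n (A B : 'M[R[i]]_n.+1) : opnorm (A *m B) <= opnorm A * opnorm B.
Proof.
have [v [v1 <- _]] := opnormP (A *m B); rewrite -mulmxA.
apply: le_trans (l2norm_mul_le A _) _; rewrite ler_wpM2l ?opnorm_ge0//.
by rewrite -[opnorm B]mulr1 -v1 l2norm_mul_le.
Qed.

Lemma opnorm_eqP n (A : 'M[R[i]]_n.+1) (c : R) (v : 'cV_n.+1) :
  (forall x, l2norm (A *m x) <= c * l2norm x) -> v != 0 ->
  l2norm (A *m v) = c * l2norm v -> opnorm A = c.
Proof.
move=> Ac v0 Av; apply/eqP; rewrite eq_le; apply/andP; split.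
  by have [w [w1 <- _]] := opnormP A; rewrite -[c]mulr1 -w1.
have v_gt0 : 0 < l2norm v by rewrite lt_def l2norm_ge0 l2norm_eq0 v0.
by rewrite -(ler_pM2r v_gt0) -Av l2norm_mul_le.
Qed.

Lemma kappa_gt0 n (A : 'M[R[i]]_n.+1) : A \in unitmx -> 0 < kappa A.
Proof. by move=> Au; rewrite mulr_gt0 ?opnorm_gt0 ?unitmx_inv. Qed.

(** * Positive definite matrices and vectors attaining the norm *)

Lemma posdefmx_unit n (A : 'M[R[i]]_n) : posdefmx A -> A \in unitmx.
Proof.
move=> [_ Apos]; rewrite -unitmx_tr -row_free_unit.
rewrite -kermx_eq0; apply/rowV0P => u /sub_kermxP.
move=> /(congr1 trmx); rewrite trmx_mul trmxK trmx0 => Au0.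
apply/eqP; apply/negPn/negP => u0.
have := Apos u^T; rewrite -mulmxA Au0 mulmx0 mxE ltxx.
by rewrite trmx_eq0 u0; case/(_ isT)/notF.
Qed.

(** The form of the inverse at [x] is the form of [A] at [invmx A *m x]. *)
Lemma posdefmx_inv n (A : 'M[R[i]]_n) : posdefmx A -> posdefmx (invmx A).
Proof.
move=> Apd; have Au := posdefmx_unit Apd; case: Apd => /hermsymmxP Ah Apos.
have Aih : (invmx A)^t* = invmx A by rewrite trmx_inv map_invmx Ah.
split; first exact/hermsymmxP.
move=> x x0; have := Apos (invmx A *m x); rewrite trmxC_mul Aih mulmxKV//.
by rewrite mulmxA; apply; apply: contraNneq x0 => Ax0; rewrite -(mulKVmx Au x) Ax0 mulmx0.
Qed.

(** With [a = opnorm A], attaining the norm gives A^2 v = a^2 v, hence (A + a)(A v - a v) = 0. Since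
    -a <= 0 is no eigenvalue of a positive definite matrix, A v = a v. *)
Lemma posdefmx_eigen n (A : 'M[R[i]]_n.+1) (v : 'cV_n.+1) :
  posdefmx A -> l2norm (A *m v) = opnorm A * l2norm v ->
  A *m v = (opnorm A)%:C *: v.
Proof.
move=> [/hermsymmxP Ah Apos] Av; set a := opnorm A in Av *.
have a0 : 0 <= a := opnorm_ge0 A.
(* |A^2 v - a^2 v|^2 = |A^2 v|^2 - 2 a^2 |A v|^2 + a^4 |v|^2 <= 0 *)
have AAv : A *m (A *m v) = (a ^+ 2)%:C *: v.
  apply/eqP; rewrite -subr_eq0 -l2norm_eq0 -sqrf_eq0 eq_le sqr_ge0 andbT.
  suff -> : l2norm (A *m (A *m v) - (a ^+ 2)%:C *: v) ^+ 2 =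
      l2norm (A *m (A *m v)) ^+ 2 - (a * l2norm (A *m v)) ^+ 2.
    by rewrite subr_le0 ler_pXn2r ?nnegrE ?mulr_ge0 ?l2norm_ge0// l2norm_mul_le.
  apply: complexI.
  rewrite sqr_l2normBZ !trmxC_mul Ah -!mulmxA.
  have AvE : (v^t* *m (A *m (A *m v))) 0 0 = ((a * l2norm v) ^+ 2)%:C.
    by rewrite -Av sqr_l2normC trmxC_mul Ah -!mulmxA.
  rewrite !AvE Av -rmorphM -!rmorphB -rmorphD /=; congr (_%:C).
  ring.
have : A *m (A *m v - a%:C *: v) = - a%:C *: (A *m v - a%:C *: v).
  by rewrite mulmxBr AAv -scalemxAr scaleNr scalerBr opprB scalerA -rmorphM expr2.
move=> Au; apply/eqP; rewrite -subr_eq0; apply/negPn/negP => u0.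
have := Apos _ u0; rewrite -mulmxA Au -scalemxAr mxE -sqr_l2normC.
by rewrite -rmorphN -rmorphM ltcR ltNge mulNr oppr_le0 mulr_ge0 ?sqr_ge0.
Qed.

(** At a unit vector [v] attaining |XY|, the chain |XYv| <= |X||Yv| <= |X||Y| is tight. So [Y]
    attains its norm at [v], which is then an eigenvector of [Y], and [X] attains its norm at [v]
    too. *)
Lemma opnormM_eq_eigen n (X Y : 'M[R[i]]_n.+1) :
  posdefmx X -> posdefmx Y -> opnorm (X *m Y) = opnorm X * opnorm Y ->
  exists2 v : 'cV_n.+1, v != 0 & X *m v = (opnorm X)%:C *: v /\ Y *m v = (opnorm Y)%:C *: v.
Proof.
move=> Xpd Ypd XY; have [v [v1 XYv _]] := opnormP (X *m Y).
have Y0 : 0 < opnorm Y := opnorm_gt0 (posdefmx_unit Ypd).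
have X0 : 0 < opnorm X := opnorm_gt0 (posdefmx_unit Xpd).
have Yv : l2norm (Y *m v) = opnorm Y * l2norm v.
  apply/eqP; rewrite eq_le l2norm_mul_le v1 mulr1 /= -(ler_pM2l X0) -XY -XYv -mulmxA.
  exact: l2norm_mul_le.
have YvE := posdefmx_eigen Ypd Yv.
exists v; first by rewrite -l2norm_eq0 v1 oner_eq0.
split; last exact: YvE.
apply: (posdefmx_eigen Xpd); rewrite v1.
have : opnorm X * opnorm Y = opnorm Y * l2norm (X *m v).
  apply: etrans (esym XY) _; apply: etrans (esym XYv) _.
  by rewrite -mulmxA YvE -scalemxAr (l2normZ _ (ltW Y0)).
move: (opnorm X) (opnorm Y) (l2norm _) Y0 => a b c b0 abc.
by apply: (mulfI (lt0r_neq0 b0)); rewrite -abc mulr1 mulrC.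
Qed.

(** Here |x| <= |A^-1||Ax| reads |A||x| <= |Ax|, so every vector attains the norm and is an
    eigenvector for [opnorm A]. *)
Lemma opnorm_eq_scalar n (A : 'M[R[i]]_n.+1) :
  posdefmx A -> kappa A = 1 -> A = (opnorm A)%:C%:M.
Proof.
move=> Apd kA; have Au := posdefmx_unit Apd; have A0 := opnorm_gt0 Au.
have eigenA (x : 'cV_n.+1) : A *m x = (opnorm A)%:C *: x.
  apply: posdefmx_eigen => //; apply/eqP; rewrite eq_le l2norm_mul_le /=.
  have -> : l2norm (A *m x) = opnorm A * (opnorm (invmx A) * l2norm (A *m x)).
    by rewrite mulrA -/(kappa A) kA mul1r.
  by rewrite ler_pM2l// -{1}(mulKmx Au x) l2norm_mul_le.
by apply: mulmx_cV_inj => x; rewrite eigenA mul_scalar_mx.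
Qed.

(** * Rank arguments *)

(* A rank one matrix satisfies C^2 = tr(C) C, while C^2 = - C^* C. *)
Lemma skew_hermitian_rank1_tr0 (n : nat) (A : 'M[R[i]]_n) :
  A^t* = - A -> \tr A = 0 -> (\rank A <= 1)%N -> A = 0.
Proof.
move=> Ask Atr rk1.
have AA : A *m A = 0.
  (* In the factorization of [A] through its rank, the inner product of the factors is a square
     matrix of size at most 1 with the trace of [A], hence zero. *)
  rewrite -(mulmx_base A) mulmxA -[in X in X *m _]mulmxA.
  suff -> : row_base A *m col_base A = 0 by rewrite mulmx0 mul0mx.
  move: Atr; rewrite -{1}(mulmx_base A) mxtrace_mulC.
  move: (row_base A *m col_base A) rk1; case: (\rank A) => [|[|//]] B _ Btr.
    by apply/matrixP => -[].
  rewrite (mx11_scalar B); move: Btr; rewrite {1}(mx11_scalar B) mxtrace_scalar.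
  by move=> /eqP; rewrite mulr1n => /eqP ->; rewrite raddf0.
have Ax (x : 'cV_n) : A *m x = 0.
  apply/eqP; rewrite -l2norm_eq0 -sqrf_eq0; apply/eqP/complexI.
  by rewrite sqr_l2normC trmxC_mul Ask -mulmxA mulNmx (mulmxA A) AA mul0mx oppr0 mulmx0 mxE.
by apply: mulmx_cV_inj => x; rewrite Ax mul0mx.
Qed.

(** Applying [A] to a relation c v + d w = 0 and subtracting b times that relation leaves c (a - b)
    v = 0. *)
Lemma eigen2_rank (K : fieldType) n (A : 'M[K]_n) (v w : 'cV_n) (a b : K) :
  v != 0 -> w != 0 -> A *m v = a *: v -> A *m w = b *: w -> a != b ->
  \rank (row_mx v w) = 2%N.
Proof.
move=> v0 w0 Av Aw ab; rewrite -mxrank_tr; apply/eqP.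
rewrite -[_ == _]/(row_free (row_mx v w)^T) -kermx_eq0; apply/rowV0P => u /sub_kermxP.
move=> /(congr1 trmx); rewrite trmx_mul trmxK trmx0 => /[dup].
rewrite -[u]hsubmxK (mx11_scalar (lsubmx u)) (mx11_scalar (rsubmx u)).
move: (lsubmx u 0 0) (rsubmx u 0 0) => c d.
rewrite tr_row_mx mul_row_col !tr_scalar_mx !mul_mx_scalar => vw /(congr1 (mulmx A)).
rewrite mulmx0 mulmxDr -!scalemxAr Av Aw => Avw.
have c0 : c = 0.
  have /eqP : (c * (a - b)) *: v = 0.
    rewrite -Avw !scalerA (mulrC d) -(scalerA b) (_ : d *: w = - (c *: v)).
      by rewrite scalerN scalerA -scalerBl mulrBr (mulrC b).
    by apply/eqP; rewrite -addr_eq0 addrC vw.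
  by rewrite scaler_eq0 mulf_eq0 subr_eq0 (negbTE ab) (negbTE v0) !orbF => /eqP.
move: vw; rewrite c0 scale0r add0r => /eqP; rewrite scaler_eq0 (negbTE w0) orbF => /eqP ->.
by rewrite !raddf0 row_mx0.
Qed.

(** * The equality case in dimension at most 3 *)

Lemma OLC_mulP n (X Y : 'M[R[i]]_n.+1) : X \in unitmx -> Y \in unitmx ->
  OLC (X *m Y) = OLC X + OLC Y <-> kappa (X *m Y) = kappa X * kappa Y.
Proof.
move=> Xu Yu; have XYu : X *m Y \in unitmx by rewrite unitmx_mul Xu.
have [[kX kY] kXY] := (kappa_gt0 Xu, kappa_gt0 Yu, kappa_gt0 XYu).
rewrite /OLC; move: (kappa X) (kappa Y) (kappa _) kX kY kXY => a b c a0 b0 c0.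
rewrite -mulrDr -lnM ?posrE//; split=> [|->//].
by move=> /mulfI; rewrite invr_eq0 pnatr_eq0 => /(_ isT) /ln_inj; apply; rewrite posrE// mulr_gt0.
Qed.

(** Two submultiplicativity bounds between positive numbers whose products agree must both be
    equalities. *)
Lemma kappa_mul_eq n (X Y : 'M[R[i]]_n.+1) : X \in unitmx -> Y \in unitmx ->
  kappa (X *m Y) = kappa X * kappa Y ->
  opnorm (X *m Y) = opnorm X * opnorm Y /\
  opnorm (invmx Y *m invmx X) = opnorm (invmx Y) * opnorm (invmx X).
Proof.
move=> Xu Yu; have XYu : X *m Y \in unitmx by rewrite unitmx_mul Xu.
have XYi : invmx (X *m Y) = invmx Y *m invmx X.
  by apply: (can_inj (mulKmx XYu)); rewrite mulmxV// mulmxA mulmxK ?mulmxV.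
rewrite /kappa XYi => kXY.
have [le1 le2] := (opnormM X Y, opnormM (invmx Y) (invmx X)).
have p1 : 0 < opnorm (X *m Y) by exact: opnorm_gt0.
have p2 : 0 < opnorm (invmx Y *m invmx X).
  by apply: opnorm_gt0; rewrite unitmx_mul !unitmx_inv Yu.
move: le1 le2 p1 p2 kXY.
move: (opnorm (X *m Y)) (opnorm (invmx Y *m invmx X)) => p q.
move: (opnorm X) (opnorm Y) (opnorm (invmx X)) (opnorm (invmx Y)) => a b a' b'.
rewrite mulrACA (mulrC a') => pc qd p0 q0 pqcd; have c0 := lt_le_trans p0 pc.
split; apply/eqP; rewrite eq_le ?pc ?qd /=.
  by rewrite -(ler_pM2r q0) pqcd ler_wpM2l// ltW.
by rewrite -(ler_pM2l p0) pqcd ler_wpM2r// (le_trans (ltW q0)).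
Qed.

Lemma posdefmx_OLC_comm n (X Y : 'M[R[i]]_n) : (n <= 3)%N ->
  posdefmx X -> posdefmx Y -> OLC (X *m Y) = OLC X + OLC Y -> X *m Y = Y *m X.
Proof.
(* Dimension 0 is separate: the norm lemmas concern size [n.+1]. *)
case: n X Y => [|n] X Y n3 Xpd Ypd; first by move=> _; apply/matrixP => -[].
have [Xu Yu] := (posdefmx_unit Xpd, posdefmx_unit Ypd).
move=> /(OLC_mulP Xu Yu) /(kappa_mul_eq Xu Yu)[XY YXi].
have [kX1|kX1] := eqVneq (kappa X) 1.
  by rewrite (opnorm_eq_scalar Xpd kX1) scalar_mxC.
have [v v0 [Xv Yv]] := opnormM_eq_eigen Xpd Ypd XY.
have [w w0 [Yiw Xiw]] := opnormM_eq_eigen (posdefmx_inv Ypd) (posdefmx_inv Xpd) YXi.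
have inv_eigen (A : 'M[R[i]]_n.+1) : A \in unitmx ->
    invmx A *m w = (opnorm (invmx A))%:C *: w -> A *m w = (opnorm (invmx A))^-1%:C *: w.
  move=> Au Aw; have ai0 : opnorm (invmx A) != 0 by rewrite gt_eqF ?opnorm_gt0 ?unitmx_inv.
  rewrite -{2}(mulKVmx Au w) Aw -scalemxAr scalerA -rmorphM mulVf// rmorph1 scale1r//.
have Xw := inv_eigen X Xu Xiw; have Yw := inv_eigen Y Yu Yiw.
apply/eqP; rewrite -subr_eq0; apply/eqP.
have [/hermsymmxP Xh _] := Xpd; have [/hermsymmxP Yh _] := Ypd.
apply: skew_hermitian_rank1_tr0.
- by rewrite linearB /= map_mxB !trmxC_mul Xh Yh opprB.
- by rewrite linearB /= mxtrace_mulC subrr.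
have comm0 (u : 'cV[R[i]]_n.+1) (a b : R[i]) : X *m u = a *: u -> Y *m u = b *: u ->
    (X *m Y - Y *m X) *m u = 0.
  move=> Xu' Yu'; rewrite mulmxBl -!mulmxA Xu' Yu' -!scalemxAr Xu' Yu' !scalerA.
  by rewrite mulrC subrr.
have : (X *m Y - Y *m X) *m row_mx v w = 0.
  by rewrite mul_mx_row (comm0 v _ _ Xv Yv) (comm0 w _ _ Xw Yw) row_mx0.
(* The commutator has rank at most [n.+1 - 2], hence at most 1. *)
move=> /mulmx0_rank_max; rewrite (eigen2_rank v0 w0 Xv Xw).
  by move=> h; rewrite -(leq_add2r 2) (leq_trans h).
(* Equal eigenvalues |X| = 1/|X^-1| would give [kappa X = 1], the case settled above. *)
apply: contra_neq kX1 => /complexI aE; rewrite /kappa aE mulVf//.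
by rewrite gt_eqF ?opnorm_gt0 ?unitmx_inv.
Qed.

(** * The example in dimension 4 *)

(** The lower bound says |A^-1| <= 1, attained at the fixed vector [w]; the upper bound, attained at
    [v], gives |A| = c. *)
Lemma kappa_eq n (A : 'M[R[i]]_n.+1) (c : R) (v w : 'cV_n.+1) :
  A \in unitmx ->
  (forall x, l2norm x <= l2norm (A *m x)) ->
  (forall x, l2norm (A *m x) <= c * l2norm x) ->
  v != 0 -> l2norm (A *m v) = c * l2norm v -> w != 0 -> A *m w = w -> kappa A = c.
Proof.
move=> Au Alo Aup v0 Av w0 Aw; rewrite /kappa (opnorm_eqP Aup v0 Av).
rewrite (_ : opnorm (invmx A) = 1) ?mulr1//; apply: (opnorm_eqP (v := w)) => [x||] //.
  by rewrite mul1r -{2}(mulKVmx Au x) Alo.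
by rewrite mul1r -{1}Aw mulKmx.
Qed.

(** All members of this family share the first and last basis vectors as eigenvectors, for 4 and 1;
    only the middle block varies. *)
Definition gap_mx (p q r : R) : 'M[R[i]]_4 :=
  \matrix_(i, j) (nth 0 (nth [::]
    [:: [:: 4; 0; 0; 0]; [:: 0; p; q; 0]; [:: 0; q; r; 0]; [:: 0; 0; 0; 1]] i) j)%:C.

Lemma sum_ord4 (V : nmodType) (F : 'I_4 -> V) :
  \sum_(i < 4) F i = F 0 + F 1 + F 2 + F 3.
Proof.
rewrite !big_ord_recr big_ord0 /= add0r.
by congr (F _ + F _ + F _ + F _); apply: val_inj.
Qed.

Lemma gap_mulE p q r (x : 'cV[R[i]]_4) :
  [/\ (gap_mx p q r *m x) 0 0 = 4%:C * x 0 0,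
      (gap_mx p q r *m x) 1 0 = p%:C * x 1 0 + q%:C * x 2 0,
      (gap_mx p q r *m x) 2 0 = q%:C * x 1 0 + r%:C * x 2 0 &
      (gap_mx p q r *m x) 3 0 = x 3 0].
Proof.
by split; rewrite mxE sum_ord4 !mxE /= ?rmorph1 ?rmorph0 !(mul0r, mul1r, add0r, addr0).
Qed.

Lemma sqr_normc (a b : R) : Normc.normc (a +i* b) ^+ 2 = a ^+ 2 + b ^+ 2.
Proof. by rewrite sqr_sqrtr// addr_ge0// sqr_ge0. Qed.

(* The hypotheses say that the block [[p, q], [q, r]] lies between 1 and 4. *)
Section Gap.
Variables p q r : R.
Hypothesis form_ge : forall s t : R, s ^+ 2 + t ^+ 2 <= p * s ^+ 2 + 2 * q * s * t + r * t ^+ 2.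
Hypothesis norm_ge : forall s t : R,
  s ^+ 2 + t ^+ 2 <= (p * s + q * t) ^+ 2 + (q * s + r * t) ^+ 2.
Hypothesis norm_le : forall s t : R,
  (p * s + q * t) ^+ 2 + (q * s + r * t) ^+ 2 <= 16 * (s ^+ 2 + t ^+ 2).

(** The form dominates |x|^2: the matrix being real symmetric, its form at [x] is the sum of its
    values at the real and imaginary parts, and [form_ge] applies to each. *)
Lemma gap_posdef : posdefmx (gap_mx p q r).
Proof.
split.
  apply/hermsymmxP/matrixP => i j; rewrite !mxE.
  rewrite conjC_real.
  by case: i j => [[|[|[|[|//]]]] ?] [[|[|[|[|//]]]] ?].
move=> x x0; apply: (@lt_le_trans _ _ (l2norm x ^+ 2)%:C).
  by rewrite ltcR exprn_gt0// lt_def l2norm_ge0 l2norm_eq0 x0.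
have [g0 g1 g2 g3] := gap_mulE p q r x.
rewrite -mulmxA mxE sum_ord4 g0 g1 g2 g3 !mxE sqr_l2norm sum_ord4.
case: (x 0 0) (x 1 0) (x 2 0) (x 3 0) => [a0 b0] [a1 b1] [a2 b2] [a3 b3].
rewrite !sqr_normc lecE /=.
have := form_ge a1 a2; have := form_ge b1 b2.
have := sqr_ge0 a0; have := sqr_ge0 b0.
move=> h1 h2 h3 h4; apply/andP; split; first by apply/eqP; ring.
lra.
Qed.

Lemma gap_norm_le x : l2norm (gap_mx p q r *m x) <= 4 * l2norm x.
Proof.
rewrite -(@ler_pXn2r _ 2) ?nnegrE ?mulr_ge0 ?l2norm_ge0// exprMn !sqr_l2norm !sum_ord4.
have [-> -> -> ->] := gap_mulE p q r x.
case: (x 0 0) (x 1 0) (x 2 0) (x 3 0) => [a0 b0] [a1 b1] [a2 b2] [a3 b3].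
rewrite /= !sqr_normc.
have := norm_le a1 a2; have := norm_le b1 b2.
have := sqr_ge0 a3; have := sqr_ge0 b3.
lra.
Qed.

Lemma gap_norm_ge x : l2norm x <= l2norm (gap_mx p q r *m x).
Proof.
rewrite -(@ler_pXn2r _ 2) ?nnegrE ?l2norm_ge0// !sqr_l2norm !sum_ord4.
have [-> -> -> ->] := gap_mulE p q r x.
case: (x 0 0) (x 1 0) (x 2 0) (x 3 0) => [a0 b0] [a1 b1] [a2 b2] [a3 b3].
rewrite /= !sqr_normc.
have := norm_ge a1 a2; have := norm_ge b1 b2.
have := sqr_ge0 a0; have := sqr_ge0 b0.
lra.
Qed.

End Gap.

Lemma gap_e0 p q r : gap_mx p q r *m delta_mx 0 0 = 4%:C *: delta_mx 0 0 :> 'cV_4.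
Proof.
by apply/matrixP => i j; rewrite -colE !mxE ord1;
  case: i => [[|[|[|[|//]]]] ?]; rewrite /= ?mulr1 ?mulr0.
Qed.

Lemma gap_e3 p q r : gap_mx p q r *m delta_mx 3 0 = delta_mx 3 0 :> 'cV_4.
Proof.
by apply/matrixP => i j; rewrite -colE !mxE ord1; case: i => [[|[|[|[|//]]]] ?].
Qed.

Lemma ex_noncommuting_OLC4 : exists X Y : 'M[R[i]]_4,
  [/\ posdefmx X, posdefmx Y, OLC (X *m Y) = OLC X + OLC Y & X *m Y <> Y *m X].
Proof.
(* The blocks diag(2, 1) and [[2, 1], [1, 2]] have eigenvalues 1, 2 and 1, 3, all between 1 and 4,
   and do not commute. *)
pose X := gap_mx 2 0 1; pose Y := gap_mx 2 1 2.
have Xpd : posdefmx X by apply: gap_posdef => s t; have := sqr_ge0 s; have := sqr_ge0 (s + t); nra.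
(* For [Y] the slack in the lower bounds is (s + t)^2 for the form and 4 (s + t)^2 for the norm; in
   the upper bound it is 4 (s - t)^2 + 7 (s^2 + t^2). *)
have Ypd : posdefmx Y by apply: gap_posdef => s t; have := sqr_ge0 s; have := sqr_ge0 (s + t); nra.
have Xge x : l2norm x <= l2norm (X *m x) by apply: gap_norm_ge => s t; have := sqr_ge0 s; have := sqr_ge0 (s + t); nra.
have Yge x : l2norm x <= l2norm (Y *m x) by apply: gap_norm_ge => s t; have := sqr_ge0 s; have := sqr_ge0 (s + t); nra.
have Xle x : l2norm (X *m x) <= 4 * l2norm x by apply: gap_norm_le => s t; have := sqr_ge0 s; have := sqr_ge0 t; have := sqr_ge0 (s - t); nra.
have Yle x : l2norm (Y *m x) <= 4 * l2norm x by apply: gap_norm_le => s t; have := sqr_ge0 s; have := sqr_ge0 t; have := sqr_ge0 (s - t); nra.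
have [Xu Yu] := (posdefmx_unit Xpd, posdefmx_unit Ypd).
have delta_neq0 i : delta_mx i 0 != 0 :> 'cV[R[i]]_4.
  by apply/eqP => /matrixP /(_ i 0) /eqP; rewrite !mxE !eqxx oner_eq0.
exists X, Y; split=> //.
  have kX : kappa X = 4.
    apply: (kappa_eq Xu Xge Xle (delta_neq0 0) _ (delta_neq0 3)); last exact: gap_e3.
    by rewrite gap_e0 l2normZ.
  have kY : kappa Y = 4.
    apply: (kappa_eq Yu Yge Yle (delta_neq0 0) _ (delta_neq0 3)); last exact: gap_e3.
    by rewrite gap_e0 l2normZ.
  apply/(OLC_mulP Xu Yu); rewrite kX kY.
  (* The bounds for [X] and [Y] compose to 1 and 4 * 4, attained at the shared eigenvectors. *)
  apply: (kappa_eq _ _ _ (delta_neq0 0) _ (delta_neq0 3)).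
  - by rewrite unitmx_mul Xu.
  - by move=> x; rewrite -mulmxA; apply: le_trans (Yge x) (Xge _).
  - move=> x; rewrite -mulmxA -mulrA; apply: le_trans (Xle _) _.
    by rewrite ler_pM2l.
  - by rewrite -mulmxA gap_e0 -scalemxAr gap_e0 !l2normZ// mulrA.
  - by rewrite -mulmxA !gap_e3.
(* This entry is 2 in [X *m Y] and 1 in [Y *m X]. *)
move=> /matrixP /(_ 1 2); rewrite !mxE !sum_ord4 !mxE /=.
move=> /(congr1 (@complex.Re R)) /=; lra.
Qed.

End OperatorNorm.

Theorem theorem4p4 (R : realType) :
  (forall (n : nat) (X Y : 'M[R[i]]_n),
     (n <= 3)%N -> posdefmx X -> posdefmx Y ->
     OLC (X *m Y) = OLC X + OLC Y -> X *m Y = Y *m X) /\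
  (exists X Y : 'M[R[i]]_4,
     [/\ posdefmx X, posdefmx Y,
         OLC (X *m Y) = OLC X + OLC Y & X *m Y <> Y *m X]).
Proof.
by split; [exact: posdefmx_OLC_comm | exact: ex_noncommuting_OLC4].
Qed.
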